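(* Assume the weighted digraph $V$ on vertex set $\mathcal N$ ($|\mathcal N|=N$) has at least one spanning tree. Then for every $k\in\{1,\dots,N\}$, every minimal forest $F\in\tilde{\mathcal F}^k$ and every atom $\mathcal E$ of the algebra $\mathfrak A_k$, the induced subgraph $F|_{\mathcal E}$ is a tree (i.e. it is weakly connected).
   Context: $V$ is a digraph with vertex set $\mathcal N$ and real weights $v_{ij}$ on its arcs $(i,j)$. An (entering) forest is a digraph in which every vertex has at most one outgoing arc and which contains no directed cycle; its weakly connected components are called trees; the unique vertex of a tree with no outgoing arc is its root. A spanning forest is a forest which is a subgraph of $V$ with vertex set $\mathcal N$; $\mathcal F^k$ denotes the set of spanning forests consisting of exactly $k$ trees. For a subgraph $G$ of $V$, $\Upsilon^G=\sum_{(i,j)\in\mathcal AG}v_{ij}$. Put $\phi^k=\min_{F\in\mathcal F^k}\Upsilon^F$ and $\tilde{\mathcal F}^k=\{F\in\mathcal F^k:\Upsilon^F=\phi^k\}$ (minimal forests). $\mathfrak A_k$ is the algebra of subsets of $\mathcal N$ generated (by taking complements and intersections) by the vertex sets of all trees of all forests in $\tilde{\mathcal F}^k$. An atom of $\mathfrak A_k$ is a nonempty $\mathcal A\in\mathfrak A_k$ such that $\mathcal A\cap\mathcal B\in\{\emptyset,\mathcal A\}$ for all $\mathcal B\in\mathfrak A_k$. For a digraph $G$ and $\mathcal S\subseteq\mathcal N$, $G|_{\mathcal S}$ is the subgraph induced by $\mathcal S$ (vertex set $\mathcal S$, all arcs of $G$ with both ends in $\mathcal S$). A graph with a single vertex and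 no arcs counts as a tree. *)

(* Defs.v *)
From mathcomp Require Import all_boot all_order all_algebra.
Set Implicit Arguments. Unset Strict Implicit. Unset Printing Implicit Defensive.
Import Order.TTheory GRing.Theory Num.Theory.
Local Open Scope ring_scope.

Section Forests.
Variable T : finType.

(* A subgraph with vertex set T is given by its arc set A : {set T * T}. *)
Definition arc_rel (A : {set T * T}) : rel T := fun i j => (i, j) \in A.

Definition wconnect (A : {set T * T}) : rel T :=
  connect (fun i j => arc_rel A i j || arc_rel A j i).

Definition out_le1 (A : {set T * T}) : Prop :=
  forall i : T, (#|[set j | (i, j) \in A]| <= 1)%N.

Definition acyclic (A : {set T * T}) : Prop :=
  forall i j : T, arc_rel A i j -> ~~ connect (arc_rel A) j i.

Definition spanning_forest (V : rel T) (A : {set T * T}) : Prop :=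
  [/\ forall i j, (i, j) \in A -> V i j, out_le1 A & acyclic A].

Definition tree_sets (A : {set T * T}) : {set {set T}} :=
  [set [set y | wconnect A x y] | x : T].

Definition num_trees (A : {set T * T}) : nat := #|tree_sets A|.

Definition forest_k (V : rel T) (k : nat) (A : {set T * T}) : Prop :=
  spanning_forest V A /\ num_trees A = k.

Definition weight (R : numDomainType) (v : T -> T -> R) (A : {set T * T}) : R :=
  \sum_(a in A) v a.1 a.2.

Definition minimal_forest (R : numDomainType) (V : rel T) (v : T -> T -> R)
    (k : nat) (A : {set T * T}) : Prop :=
  forest_k V k A /\ forall B, forest_k V k B -> weight v A <= weight v B.

Inductive in_gen_algebra (G : {set T} -> Prop) : {set T} -> Prop :=
| alg_gen S : G S -> in_gen_algebra G S
| alg_compl S : in_gen_algebra G S -> in_gen_algebra G (~: S)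
| alg_inter S1 S2 : in_gen_algebra G S1 -> in_gen_algebra G S2 ->
    in_gen_algebra G (S1 :&: S2).

Definition algebra_k (R : numDomainType) (V : rel T) (v : T -> T -> R)
    (k : nat) : {set T} -> Prop :=
  in_gen_algebra (fun S => exists F, minimal_forest V v k F /\ S \in tree_sets F).

Definition atom (Alg : {set T} -> Prop) (E : {set T}) : Prop :=
  [/\ E != set0, Alg E & forall B, Alg B -> E :&: B = set0 \/ E :&: B = E].

Definition induced (A : {set T * T}) (S : {set T}) : {set T * T} :=
  [set a in A | (a.1 \in S) && (a.2 \in S)].

Definition weakly_connected_on (S : {set T}) (A : {set T * T}) : Prop :=
  forall x y, x \in S -> y \in S -> wconnect A x y.

End Forests.

(* Main.v *)
Require Import Defs.
From mathcomp Require Import all_boot all_order all_algebra.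
From mathcomp Require Import ring lra.
Import Order.TTheory GRing.Theory Num.Theory.
Set Implicit Arguments. Unset Strict Implicit. Unset Printing Implicit Defensive.

(* A forest is a successor function [f : T -> option T], [None] marking roots, and
   the basic operation is the exchange of the values of two forests on a set [D].
   If both results are acyclic, optimality of the two forests passes to them.

   The minimal weight as a function of the number of trees is convex, so there is
   a price [l] per tree for which the minimal [k]-forests are exactly the optimal
   forests with [k] trees.

   An atom consists of the vertices that lie in the same tree of every minimal
   forest. Let [F], [G] be minimal, [S] a tree of [G] with root [h], and let [x], [y]
   in [S] lie in different components of the restriction of [F] to [S].
   Exchanging parts of these components, completed by a packing argument in the
   style of Lovasz's proof of Edmonds' disjoint branchings theorem, gives a minimal
   forest in which one of [x], [y] is led to [h] and the other one follows [F].
   Hence the path of [F] between two vertices of an atom cannot leave the atom. *)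

(** * Forests as successor functions: roots, trees and exchanges *)

Section SuccessorFunctions.
Variable T : finType.
Implicit Types (f g : {ffun T -> option T}) (X S P W D : {set T}) (x y z u h : T).

Definition stays f X z := if f z is Some z' then z' \in X else false.

(** Call a set trapping when all its vertices stay in it: a cycle is trapping, and a nonempty
    trapping set contains a cycle. An exchange is then shown acyclic by cutting a trapping set down
    until one forest alone governs it. *)
Definition acyc f := forall X, (forall z, z \in X -> stays f X z) -> X = set0.

Definition step f : rel T := fun a b => f a == Some b.

(** The default [z] is never taken for acyclic [f], where every vertex leads to a root. *)
Definition rt f z := odflt z [pick u | (f u == None) && connect (step f) z u].

Definition mix D f g := [ffun z => if z \in D then f z else g z].

(** A vertex whose arc leaves [S] becomes a root, so the roots of the restriction label the
    components of [f] inside [S]. *)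
Definition restr f S :=
  [ffun z => if f z is Some z' then if z' \in S then Some z' else None else None].

Definition sinks f := [set z | f z == None].

Definition tree f h := [set z | rt f z == h].

Lemma mixE D f g z : mix D f g z = if z \in D then f z else g z.
Proof. by rewrite ffunE. Qed.

Lemma staysP f X z : reflect (exists2 z', f z = Some z' & z' \in X) (stays f X z).
Proof.
rewrite /stays; case E: (f z) => [z'|]; last by constructor; case.
by apply: (iffP idP) => [H|[_ [<-]]//]; exists z'.
Qed.

Lemma acyc_leaves f X z : acyc f -> z \in X -> exists2 u, u \in X & ~~ stays f X u.
Proof.
move=> af zX; apply/exists_inP; apply: contraTT zX; rewrite negb_exists_in.
move/forall_inP=> H; rewrite (af X) ?inE // => u uX.
by move: (H u uX); rewrite negbK.
Qed.

Lemma restr_acyc f S : acyc f -> acyc (restr f S).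
Proof.
move=> af X cX; apply: af => z /cX; rewrite /stays ffunE.
by case: (f z) => // z'; case: ifP.
Qed.

Lemma restr_Some f S z z' : f z = Some z' -> z' \in S -> restr f S z = Some z'.
Proof. by rewrite ffunE => -> ->. Qed.

Lemma restr_None f S z z' : restr f S z = None -> f z = Some z' -> z' \notin S.
Proof. by rewrite ffunE => + E; rewrite E; case: ifP. Qed.

Lemma connect_stepE f z u : connect (step f) z u ->
  z = u \/ exists2 z', f z = Some z' & connect (step f) z' u.
Proof.
case/connectP => -[|z' p] /= pth ->; [by left | right].
case/andP: pth => /eqP fz pth; exists z' => //.
by apply/connectP; exists p.
Qed.

Lemma connect_Some f z z' u : f z = Some z' -> f u = None ->
  connect (step f) z u -> connect (step f) z' u.
Proof. by move=> fz fu /connect_stepE[zu|[? ]]; [move: fz; rewrite zu fu|rewrite fz => -[<-]]. Qed.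

Lemma connect_root_uniq f z u r : f u = None -> f r = None ->
  connect (step f) z u -> connect (step f) z r -> u = r.
Proof.
move=> fu fr /connectP[p]; elim: p z => [|a p IHp] z /=.
  by move=> _ <- /connect_stepE[//|[z']]; rewrite fu.
case/andP => /eqP fz pth e /(connect_Some fz fr); exact: IHp.
Qed.

Lemma rtP f z : acyc f -> f (rt f z) = None /\ connect (step f) z (rt f z).
Proof.
move=> af; rewrite /rt; case: pickP => [u /andP[/eqP ? ?] //|no].
have zX : z \in [set u | connect (step f) z u] by rewrite inE.
have [u] := acyc_leaves af zX; rewrite inE => zu; rewrite /stays.
case E: (f u) => [u'|]; last by move: (no u); rewrite E eqxx zu.
by rewrite inE (connect_trans zu) //; apply: connect1; rewrite /step E.
Qed.

Lemma rt_uniq f z u : acyc f -> f u = None -> connect (step f) z u -> rt f z = u.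
Proof. move=> af fu zu; have [fr zr] := rtP z af; exact: connect_root_uniq zr zu. Qed.

Lemma rt_root f z : acyc f -> f z = None -> rt f z = z.
Proof. by move=> af fz; apply: rt_uniq. Qed.

Lemma rt_Some f z z' : acyc f -> f z = Some z' -> rt f z = rt f z'.
Proof.
move=> af fz; have [fr zr] := rtP z' af; apply: rt_uniq => //.
by apply: connect_trans zr; apply: connect1; rewrite /step fz.
Qed.

Lemma connect_stable (e : rel T) X x y :
  (forall a b, a \in X -> e a b -> b \in X) -> x \in X -> connect e x y -> y \in X.
Proof.
move=> cX xX /connectP[p pth ->] {y}.
elim: p x xX pth => //= a p IHp x xX /andP[/(cX _ _ xX) aX]; exact: IHp.
Qed.

Lemma rt_closed f X z : acyc f -> (forall a b, a \in X -> f a = Some b -> b \in X) ->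
  z \in X -> rt f z \in X.
Proof.
move=> af cX zX; have [_] := rtP z af; apply: connect_stable zX => a b aX /eqP; exact: cX.
Qed.

Lemma connect_agree f g X x y : (forall a, a \in X -> f a = g a) ->
  (forall a b, a \in X -> f a = Some b -> b \in X) ->
  x \in X -> connect (step f) x y -> connect (step g) x y.
Proof.
move=> fg cX xX /connectP[p pth ->] {y}.
elim: p x xX pth => //= a p IHp x xX /andP[/eqP fx pth].
apply: connect_trans (IHp _ (cX _ _ xX fx) pth).
by apply: connect1; rewrite /step -fg // fx.
Qed.

Lemma rt_agree f g X z : acyc f -> acyc g -> (forall a, a \in X -> f a = g a) ->
  (forall a b, a \in X -> f a = Some b -> b \in X) -> z \in X -> rt f z = rt g z.
Proof.
move=> af ag fg cX zX; have [fr zr] := rtP z af.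
apply/esym/rt_uniq => //; last exact: (connect_agree fg cX zX zr).
by rewrite -fg //; apply: (rt_closed af cX).
Qed.

Section Trees.
Variables (g : {ffun T -> option T}) (h : T).
Hypotheses (ag : acyc g) (gh : g h = None).
Let S := tree g h.

Lemma tree_next z z' : g z = Some z' -> (z' \in S) = (z \in S).
Proof. by move=> gz; rewrite !inE (rt_Some ag gz). Qed.

Lemma root_in_tree : h \in S. Proof. by rewrite inE rt_root. Qed.

Lemma tree_root z : z \in S -> g z = None -> z = h.
Proof. by rewrite inE => /eqP <- gz; rewrite rt_root. Qed.

Variable f : {ffun T -> option T}.
Hypothesis af : acyc f.

(** Arcs of [g] never cross the boundary of [S], so the part of [X] outside [S] would be trapping
    for the acyclic [g]. *)
Lemma acyc_sub_tree f' X : (forall z, z \notin S -> f' z = g z) ->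
  (forall z, z \in X -> stays f' X z) -> {subset X <= S}.
Proof.
move=> e cX z zX; apply: contraT => zS.
suff X0 : X :\: S = set0 by move/setP/(_ z): X0; rewrite in_setD in_set0 zS zX.
apply: ag => u; rewrite in_setD => /andP[uS /cX /staysP[u']]; rewrite e // => gu u'X.
by apply/staysP; exists u'; rewrite // in_setD u'X (tree_next gu) uS.
Qed.

Lemma mix_tree_acyc : acyc (mix S f g).
Proof.
move=> X cX; apply: af => z zX.
have sXS : {subset X <= S} by apply: acyc_sub_tree cX => u /negPf; rewrite mixE => ->.
by move: (cX z zX); rewrite /stays mixE sXS.
Qed.

Lemma mix_tree_acycC : acyc (mix S g f).
Proof.
move=> X cX.
have X0 : X :&: S = set0.
  apply: ag => z; rewrite in_setI => /andP[/cX /staysP[z']]; rewrite mixE => + z'X zS.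
  by rewrite zS => gz; apply/staysP; exists z'; rewrite // in_setI z'X (tree_next gz).
apply: af => z zX; move: (cX z zX); rewrite /stays mixE; case: ifP => // zS.
by move/setP/(_ z): X0; rewrite in_setI in_set0 zX zS.
Qed.

Variable r : T.
Let C := [set z in S | rt (restr f S) z == r].

Lemma component_next z z' : z \in S -> f z = Some z' -> z' \in S -> (z' \in C) = (z \in C).
Proof.
move=> zS fz z'S; rewrite ![_ \in C]inE zS z'S.
by rewrite (rt_Some (restr_acyc (S := S) af) (restr_Some fz z'S)).
Qed.

Lemma component_root z : z \in C -> restr f S z = None -> z = r.
Proof. by rewrite inE => /andP[_ /eqP <-] rz; rewrite rt_root //; apply: restr_acyc. Qed.

Variable P : {set T}.
Hypotheses (sPC : P \subset C).
Hypothesis cfP : forall z z', z \in P -> f z = Some z' -> z' \in C -> z' \in P.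
Hypothesis cgP : forall z z', z \in P -> g z = Some z' -> z' \in C -> z' \in P.

Lemma part_sub_tree z : z \in P -> z \in S.
Proof. by move/(subsetP sPC); rewrite inE => /andP[]. Qed.

Lemma part_next z z' : z \in P -> f z = Some z' -> z' \in S -> z' \in P.
Proof.
move=> zP fz z'S; apply: (cfP zP fz).
by rewrite (component_next (part_sub_tree zP) fz z'S) (subsetP sPC).
Qed.

(** An [f]-arc from [P] that stays in [S] stays in the component [C], hence in [P]. So the part of a
    trapping set in [P] traps [f] and is empty, which leaves [g] alone. *)
Lemma mix_part_acyc : acyc (mix P f g).
Proof.
move=> X cX.
have sXS : {subset X <= S}.
  apply: acyc_sub_tree cX => u uS; rewrite mixE; case: ifP => // /part_sub_tree uP.
  by rewrite uP in uS.
have X0 : X :&: P = set0.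
  apply: af => z; rewrite in_setI => /andP[zX zP]; have /staysP[z'] := cX _ zX.
  rewrite mixE zP => fz z'X; apply/staysP; exists z' => //.
  by rewrite in_setI z'X (part_next zP fz (sXS _ z'X)).
apply: ag => z zX; move: (cX z zX); rewrite /stays mixE; case: ifP => // zP.
by move/setP/(_ z): X0; rewrite in_setI in_set0 zX zP.
Qed.

(** Outside [S] the forest is [g], which confines trapping sets to [S]. There no [f]-arc enters [C]
    from outside, which confines them to [C]; closure of [P] under [g] then empties [P], and only
    [f] remains. *)
Lemma mix_part_acycC : acyc (mix P g (mix S f g)).
Proof.
move=> X cX.
have sXS : {subset X <= S}.
  apply: acyc_sub_tree cX => u uS; rewrite !mixE (negPf uS); by case: ifP.
have sXC : {subset X <= C}.
  move=> z zX; apply: contraT => zC.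
  suff X0 : X :\: C = set0 by move/setP/(_ z): X0; rewrite in_setD in_set0 zC zX.
  apply: af => u; rewrite in_setD => /andP[uC uX]; have /staysP[u'] := cX _ uX.
  have -> : mix P g (mix S f g) u = f u.
    by rewrite !mixE (sXS _ uX); case: ifP => // /(subsetP sPC) uC'; rewrite uC' in uC.
  move=> fu u'X; apply/staysP; exists u' => //.
  by rewrite in_setD u'X (component_next (sXS _ uX) fu (sXS _ u'X)) uC.
have X0 : X :&: P = set0.
  apply: ag => z; rewrite in_setI => /andP[zX zP]; have /staysP[z'] := cX _ zX.
  rewrite mixE zP => gz z'X; apply/staysP; exists z' => //.
  by rewrite in_setI z'X (cgP zP gz (sXC _ z'X)).
apply: af => z zX; move: (cX z zX); rewrite /stays !mixE (sXS _ zX); case: ifP => // zP.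
by move/setP/(_ z): X0; rewrite in_setI in_set0 zX zP.
Qed.

End Trees.
End SuccessorFunctions.

(** * Packing two branchings drawn from the arcs of two forests *)

Section Packing.
Variable T : finType.
Variables (f g : {ffun T -> option T}) (h : T).
Hypotheses (af : acyc f) (ag : acyc g) (gh : g h = None).
Implicit Types (W D X : {set T}) (z u : T) (b : bool).

Let nx b := if b then g else f.

(* The first branching, grown backwards from [h], so far spans [W] and uses [g] on [D];
   the [free] arcs are those left for the second one. *)
Let free W D z b := (z \notin W) || (b != (z \in D)).

(** The last clause is the cut condition of Edmonds' theorem: every nonempty set keeps a free choice
    that does not stay in it, a missing arc counting as such. [h] belongs to [D] because the first
    branching takes the missing arc of [g] at [h]. *)
Let good W D :=
  [/\ h \in D, D \subset W,
      forall z, z \in W -> z != h -> stays (nx (z \in D)) W z,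
      forall X, X \subset W -> (forall z, z \in X -> stays (nx (z \in D)) X z) -> X = set0
    & forall X z, z \in X -> exists p : T * bool,
        [&& p.1 \in X, free W D p.1 p.2 & ~~ stays (nx p.2) X p.1]].

(** These sets block the choice [(u, b)]: it is their only free exit, and giving it to the first
    branching would break the cut condition. *)
Let tight W D u b X :=
  [&& u \in X, free W D u b, ~~ stays (nx b) X u &
      [forall p : T * bool, (p.1 \in X) && free W D p.1 p.2 && (p != (u, b))
         ==> stays (nx p.2) X p.1]].

Let ext D u b := if b then u |: D else D.

Let good_start : good [set h] [set h].
Proof.
split; rewrite ?set11 ?subxx //.
- by move=> z; rewrite inE => ->.
- move=> X sX cX; apply/eqP; rewrite -subset0; apply/subsetP => z zX.
  have := cX z zX; have := subsetP sX z zX; rewrite inE => /eqP ->.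
  by rewrite /stays eqxx /= gh.
move=> X z zX; have [u uX nu] := acyc_leaves af zX.
by exists (u, false); rewrite /= uX nu /free inE; case: eqP.
Qed.

Let free_ext W D u b z b' : D \subset W -> u \notin W ->
  free W D z b' -> (z, b') != (u, b) -> free (u |: W) (ext D u b) z b'.
Proof.
move=> sDW uW; rewrite /free /ext !inE xpair_eqE.
have uD : u \notin D by apply: contra uW; apply: (subsetP sDW).
have [->|nzu] /= := eqVneq z u; first by case: b b' => -[] //=; rewrite ?inE ?eqxx ?(negPf uD).
by case: ifP => _; rewrite ?inE ?(negPf nzu).
Qed.

(** Only [(u, b)] ceases to be free, so a set violating the new cut condition would have been tight
    for it. *)
Let good_step W D u b w : good W D -> u \notin W -> nx b u = Some w -> w \in W ->
  (forall X, ~~ tight W D u b X) -> good (u |: W) (ext D u b).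
Proof.
move=> [hD sDW cW aW lW] uW nu wW ntight.
have hW : h \in W by apply: (subsetP sDW).
have uD : u \notin D by apply: contra uW; apply: (subsetP sDW).
have dD z : z \in W -> (z \in ext D u b) = (z \in D).
  rewrite /ext; case: ifP => // _ zW; rewrite in_setU1; case: eqP => // e.
  by rewrite -e zW in uW.
have du : (u \in ext D u b) = b.
  by rewrite /ext; case: (b); rewrite ?in_setU1 ?eqxx ?(negPf uD).
split.
- by rewrite dD.
- rewrite /ext; case: ifP => _; first exact: setUS.
  by apply: subset_trans sDW _; apply: subsetUr.
- move=> z; rewrite in_setU1 => /orP[/eqP -> _|zW zh].
    by rewrite du; apply/staysP; exists w; rewrite // in_setU1 wW orbT.
  have /staysP[z' e z'W] := cW z zW zh; rewrite dD //.
  by apply/staysP; exists z'; rewrite // in_setU1 z'W orbT.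
- move=> X sX cX.
  have hX : h \notin X.
    by apply/negP => /cX; rewrite dD // hD /stays /= gh.
  have X0 : X :&: W = set0.
    apply: aW; first exact: subsetIr.
    move=> z; rewrite in_setI => /andP[zX zW].
    have /staysP[z' e z'X] := cX z zX; rewrite dD // in e.
    have zh : z != h by apply: contraNneq hX => <-.
    have /staysP[z'' e' z''W] := cW z zW zh.
    have ez : z'' = z' by move: e'; rewrite e => -[].
    by apply/staysP; exists z'; rewrite // in_setI z'X -ez.
  have uX : u \notin X.
    apply/negP => /cX; rewrite du => /staysP[w']; rewrite nu => -[<-] wX.
    by move/setP/(_ w): X0; rewrite in_setI in_set0 wX wW.
  have sXW : X \subset W.
    apply/subsetP => z zX; have := subsetP sX z zX; rewrite in_setU1.
    by case: eqP => // e; rewrite -e zX in uX.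
  by apply: aW => // z zX; have := cX z zX; rewrite dD // (subsetP sXW).
move=> X z zX; apply/existsP; apply: contraT => /existsPn H.
have [[u0 b0] /and3P[/= u0X fr0 ns0]] := lW X z zX.
have e0 : (u0, b0) == (u, b).
  apply: contraT => ne; move: (H (u0, b0)) => /=.
  by rewrite u0X ns0 (free_ext sDW uW fr0 ne).
have [eu eb] := eqP e0; rewrite {}eu {}eb {e0} in u0X fr0 ns0.
move/negP: (ntight X) => []; rewrite /tight u0X fr0 ns0 /=.
apply/forallP => -[z' b'] /=; apply/implyP => /andP[/andP[z'X fr] ne].
by move: (H (z', b')) => /=; rewrite z'X (free_ext sDW uW fr ne) /= negbK.
Qed.

Let cand W (p : T * bool) := (p.1 \notin W) && stays (nx p.2) W p.1.

(* Two tight sets cannot cover each other's exceptional arc, so uncrossing a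
   smallest one with that of a candidate arc inside it gives a smaller one. *)
Let cand_step W D p : good W D -> cand W p ->
  exists p', cand W p' /\ forall X, ~~ tight W D p'.1 p'.2 X.
Proof.
move=> gWD cp; have [hD sDW cW aW lW] := gWD.
pose Q (q : T * bool * {set T}) := cand W q.1 && tight W D q.1.1 q.1.2 q.2.
case: (pickP Q) => [q0 Qq0|noQ]; last first.
  by exists p; split=> // X; move: (noQ (p, X)); rewrite /Q /= cp /= => ->.
have [[[u b] X] /andP[/= cu /and4P[uX fru nsu /forallP clX]] minX] :=
  @arg_minnP _ q0 Q (fun q => #|q.2|) Qq0.
have {}clX z b' : z \in X -> free W D z b' -> (z, b') != (u, b) -> stays (nx b') X z.
  by move=> zX fr ne; move: (clX (z, b')) => /=; rewrite zX fr ne.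
have uW : u \notin W by case/andP: cu.
have uY : u \in X :\: W by rewrite in_setD uW.
(* Each forest has an exit from [X :\: W]; the one of the forest not selected by [b] differs from
   [(u, b)]. Tightness then keeps it in [X], so it ends in [W] and is a candidate. *)
have [z [b' [zY nsz ne]]] : exists z b',
    [/\ z \in X :\: W, ~~ stays (nx b') (X :\: W) z & (z, b') != (u, b)].
  have [zf zfY nf] := acyc_leaves af uY; have [zg zgY ng] := acyc_leaves ag uY.
  case: (b); [exists zf, false | exists zg, true]; split=> //;
    by rewrite xpair_eqE andbF.
have /andP[zW zX] : (z \notin W) && (z \in X) by rewrite -in_setD.
have frz : free W D z b' by rewrite /free zW.
have /staysP[t ez tX] := clX z b' zX frz ne.
have tW : t \in W.
  by apply: contraNT nsz => tW; apply/staysP; exists t; rewrite // in_setD tW.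
have cz : cand W (z, b') by rewrite /cand /= zW; apply/staysP; exists t.
exists (z, b'); split=> // X' /=; apply/negP => tiX'.
have /and4P[zX' _ nsz' /forallP clX'] := tiX'.
have {}clX' z1 b1 : z1 \in X' -> free W D z1 b1 -> (z1, b1) != (z, b') -> stays (nx b1) X' z1.
  by move=> z1X fr ne1; move: (clX' (z1, b1)) => /=; rewrite z1X fr ne1.
have tX' : t \notin X'.
  by apply: contra nsz' => tX'; apply/staysP; exists t.
(* A free exit of [X :|: X'] cannot start in [X']: it would be [(z, b')], whose end [t] lies in [X].
   So it starts in [X] and is [(u, b)]. *)
have uX' : u \notin X'.
  have [[z0 b0] /and3P[/= z0X fr0 ns0]] := lW (X :|: X') z (subsetP (subsetUl _ _) z zX).
  have stU (Y : {set T}) : Y \subset X :|: X' -> ~~ stays (nx b0) Y z0.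
    move=> sY; apply: contra ns0 => /staysP[z1 e1 z1Y].
    by apply/staysP; exists z1 => //; apply: (subsetP sY).
  have z0X' : z0 \notin X'.
    apply/negP => z0X'; have := stU X' (subsetUr _ _).
    have [e|ne0] := eqVneq (z0, b0) (z, b'); last by rewrite clX'.
    case: e => e1 e2; move/negP: ns0 => [].
    by rewrite e1 e2; apply/staysP; exists t; rewrite // in_setU tX.
  move: z0X; rewrite in_setU (negPf z0X') orbF => z0X.
  have := stU X (subsetUl _ _).
  by have [[<- _]|ne0] := eqVneq (z0, b0) (u, b); last rewrite clX.
have: Q ((z, b'), X :&: X').
  rewrite /Q /= cz /tight in_setI zX zX' frz /=; apply/andP; split.
    by apply/staysP => -[t']; rewrite ez => -[<-]; rewrite in_setI (negPf tX') andbF.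
  apply/forallP => -[z1 b1] /=; apply/implyP => /andP[/andP[]].
  rewrite in_setI => /andP[z1X z1X'] fr1 ne1.
  have /staysP[t1 e1 t1X'] := clX' _ _ z1X' fr1 ne1.
  have /staysP[t2 e2 t2X] : stays (nx b1) X z1.
    by apply: clX => //; apply: contraNneq uX' => -[<- _].
  by apply/staysP; exists t1; rewrite // in_setI t1X'; move: e2; rewrite e1 => -[->]; rewrite t2X.
move/minX => /=; rewrite leqNgt => /negP[]; apply: proper_card.
by apply/properP; split; [apply: subsetIl | exists t; rewrite // in_setI (negPf tX') andbF].
Qed.

(** Candidates are adjoined until no arc of either forest enters [W] from outside. Outside [W] one
    result is then all [g] and the other all [f], with no way back into [W]. Inside [W] the second
    result takes exactly the free choices, so the cut condition makes it acyclic. *)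
Lemma disjoint_branchings : exists W D,
  [/\ h \in W,
      forall z z', f z = Some z' \/ g z = Some z' -> z' \in W -> z \in W,
      forall z, z \in W -> z != h -> stays (mix D g f) W z,
      forall z, z \notin W -> z \in D
    & [/\ h \in D, acyc (mix D g f) & acyc (mix D f g)]].
Proof.
have [W [D [gWD nc]]] : exists W D, good W D /\ forall p, ~~ cand W p.
  have: exists W D, good W D /\ #|~: W| <= #|~: [set h]|.
    by exists [set h], [set h]; split=> //; apply: good_start.
  move: #|_| => n; elim: n => [|n IHn] [W [D [gWD leW]]].
    exists W, D; split=> // p; apply/negP => /andP[pW _].
    by move: leW pW; rewrite leqn0 => /eqP/card0_eq/(_ p.1); rewrite in_setC => ->.
  case: (pickP (cand W)) => [p cp|nc]; last by exists W, D; split=> // p; rewrite nc.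
  have [[u b] [/andP[/= uW /staysP[w nu wW]] nt]] := cand_step gWD cp.
  apply: IHn; exists (u |: W), (ext D u b); split; first exact: good_step nu wW nt.
  rewrite -ltnS; apply: leq_trans leW; apply: proper_card; rewrite properC.
  by apply/properP; split; [apply: subsetUr | exists u; rewrite // in_setU1 eqxx].
have [hD sDW cW aW lW] := gWD.
have ncW b z z' : nx b z = Some z' -> z' \in W -> z \in W.
  move=> e z'W; apply: contraT => zW; case/negP: (nc (z, b)).
  by rewrite /cand /= zW; apply/staysP; exists z'.
have mE z : z \in W -> mix (D :|: ~: W) g f z = nx (z \in D) z.
  by move=> zW; rewrite mixE in_setU in_setC zW orbF; case: ifP.
have mE' z : z \in W -> mix (D :|: ~: W) f g z = nx (z \notin D) z.
  by move=> zW; rewrite mixE in_setU in_setC zW orbF; case: ifP.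
have out b (m : {ffun T -> option T}) X : (forall z, z \notin W -> m z = nx b z) ->
    (forall z, z \in X -> stays m X z) -> X \subset W.
  move=> em cX; rewrite -setD_eq0; apply/eqP.
  have an : acyc (nx b) by case: (b).
  apply: an => z; rewrite in_setD => /andP[zW /cX /staysP[z']]; rewrite em // => e z'X.
  by apply/staysP; exists z'; rewrite // in_setD z'X andbT; apply: contra zW; apply: ncW e.
exists W, (D :|: ~: W); split.
- exact: (subsetP sDW).
- by move=> z z' [e|e]; [apply: (ncW false) | apply: (ncW true)].
- by move=> z zW zh; rewrite /stays mE //; apply: cW.
- by move=> z zW; rewrite in_setU in_setC zW orbT.
split; first by rewrite in_setU hD.
- move=> X cX; have sXW : X \subset W.
    by apply: (out true) cX => z zW; rewrite mixE in_setU in_setC zW orbT.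
  by apply: aW => // z zX; move: (cX z zX); rewrite /stays mE // (subsetP sXW).
move=> X cX; have sXW : X \subset W.
  by apply: (out false) cX => z zW; rewrite mixE in_setU in_setC zW orbT.
apply/eqP; rewrite -subset0; apply/subsetP => z zX.
have [[u b] /and3P[/= uX fr /negP[]]] := lW X z zX.
have uW := subsetP sXW u uX; move: fr; rewrite /free uW /= => eb.
move: (cX u uX); rewrite /stays mE' //.
by have -> : b = (u \notin D) by move: eb; case: (b) (u \in D) => -[].
Qed.

End Packing.

(** * Exchanges between optimal forests *)

Section OptimalForests.
Variables (T : finType) (R : realFieldType) (V : rel T) (c : T -> option T -> R).
Implicit Types (f g H : {ffun T -> option T}) (S P C W D : {set T}) (x y z u h : T).

Definition allowed f := forall z z', f z = Some z' -> V z z'.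

(** Roots are priced too, by [c z None], so every exchange preserves the total cost of the two
    forests. *)
Definition cost f : R := (\sum_z c z (f z))%R.

Definition opt f := [/\ acyc f, allowed f &
  forall g, acyc g -> allowed g -> (cost f <= cost g)%R].

Lemma opt_acyc f : opt f -> acyc f. Proof. by case. Qed.
Hint Resolve opt_acyc : core.

Lemma cost_mix D f g : (cost (mix D f g) + cost (mix D g f) = cost f + cost g)%R.
Proof.
rewrite /cost -!big_split /=; apply: eq_bigr => z _; rewrite !mixE.
by case: ifP => // _; rewrite addrC.
Qed.

Lemma allowed_mix D f g : allowed f -> allowed g -> allowed (mix D f g).
Proof. by move=> vf vg z z'; rewrite mixE; case: ifP => _; [apply: vf | apply: vg]. Qed.

Lemma opt_mix D f g : opt f -> opt g -> acyc (mix D f g) -> acyc (mix D g f) ->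
  opt (mix D f g).
Proof.
move=> [af vf mf] [ag vg mg] a1 a2; have v1 := allowed_mix (D := D) vf vg.
have v2 := allowed_mix (D := D) vg vf; split=> // g' ag' vg'.
have := lerD (mf _ ag' vg') (mg _ a2 v2).
by rewrite -(cost_mix D) lerD2r.
Qed.

Definition component f g h r := [set z in tree g h | rt (restr f (tree g h)) z == r].

Lemma component_mem f g h r z :
  (z \in component f g h r) = (z \in tree g h) && (rt (restr f (tree g h)) z == r).
Proof. by rewrite inE. Qed.

Lemma opt_mix_tree f g h : opt f -> opt g -> opt (mix (tree g h) f g).
Proof.
by move=> of_ og; apply: opt_mix => //; [apply: mix_tree_acyc | apply: mix_tree_acycC]; auto.
Qed.

(** An exchange with [f] itself could create cycles passing outside the tree. It is made with the
    optimal [mix (tree g h) f g] instead, which agrees with [f] on [P]. *)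
Lemma opt_mix_part f g h r P : opt f -> opt g -> P \subset component f g h r ->
  (forall z z', z \in P -> f z = Some z' -> z' \in component f g h r -> z' \in P) ->
  (forall z z', z \in P -> g z = Some z' -> z' \in component f g h r -> z' \in P) ->
  opt (mix P f g).
Proof.
move=> of_ og sP cf cg.
have -> : mix P f g = mix P (mix (tree g h) f g) g.
  apply/ffunP => z; rewrite !mixE; case: ifP => // /(subsetP sP).
  by rewrite component_mem => /andP[->].
have af := opt_acyc of_; have ag := opt_acyc og.
apply: opt_mix => //; first exact: opt_mix_tree.
  have -> : mix P (mix (tree g h) f g) g = mix P f g.
    apply/ffunP => z; rewrite !mixE; case: ifP => // /(subsetP sP).
    by rewrite component_mem => /andP[->].
  exact: (mix_part_acyc ag af sP cf).
exact: (mix_part_acycC ag af sP cg).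
Qed.

Lemma opt_mix_comp f g h r : opt f -> opt g -> opt (mix (component f g h r) f g).
Proof. by move=> of_ og; apply: (opt_mix_part (r := r) (h := h)). Qed.

Lemma restr_root f S z : f z = None -> restr f S z = None.
Proof. by rewrite ffunE => ->. Qed.

Lemma sinks_mem f z : (z \in sinks f) = (f z == None).
Proof. by rewrite inE. Qed.

(** Two roots of [f] share a tree of [g], and one of them, [r], heads a component avoiding [h].
    Letting this component follow [f] adds the root [r] and removes none. *)
Lemma opt_increase f g : opt f -> opt g -> #|sinks g| < #|sinks f| ->
  exists2 H, opt H & #|sinks H| = #|sinks g|.+1.
Proof.
move=> of_ og lt; have af := opt_acyc of_; have ag := opt_acyc og.
have /dinjectivePn[r1 r1f [r2 /andP[r12 r2f] e]] : ~~ dinjectiveb (rt g) (sinks f).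
  apply/negP => /dinjectiveP inj; move: lt; rewrite ltnNge -(card_in_imset inj).
  case/negP; apply: subset_leq_card; apply/subsetP => _ /imsetP[z _ ->].
  by rewrite inE (rtP z ag).1.
set h := rt g r1 in e; set S := tree g h.
have gh : g h = None := (rtP r1 ag).1.
have aS := restr_acyc (S := S) af.
have [r [rS fr rh]] : exists r, [/\ r \in S, f r = None & rt (restr f S) h != r].
  rewrite !sinks_mem in r1f r2f.
  have [e1|n1] := eqVneq (rt (restr f S) h) r1.
    by exists r2; rewrite inE e1 -e eqxx (eqP r2f) eq_sym.
  by exists r1; rewrite inE eqxx (eqP r1f).
exists (mix (component f g h r) f g); first exact: opt_mix_comp.
have rg : r \notin sinks g.
  rewrite sinks_mem; apply: contraNneq rh => /(tree_root ag rS) <-.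
  by rewrite rt_root // restr_root.
have -> : #|sinks g|.+1 = #|r |: sinks g| by rewrite cardsU1 rg.
apply: eq_card => z; rewrite !inE mixE component_mem -/S.
case: (boolP (z \in S)) => zS /=; last first.
  by case: (eqVneq z r) zS => [->|//]; rewrite rS.
case: ifP => [/eqP er|nr].
  case: (eqVneq z r) => [->|nzr]; first by rewrite fr.
  have -> : (g z == None) = false.
    by apply: contraNF rh => /eqP /(tree_root ag zS) <-; rewrite er.
  by apply: contraNF nzr => /eqP /(restr_root S) rz; rewrite -er rt_root.
have [ezr|//] := eqVneq z r; move: nr; rewrite ezr rt_root ?eqxx //; exact: restr_root.
Qed.

(** Let the component of [f] around [h] follow [f]: [h] gains an arc, and no root appears because
    the tree of [h] contains no root of [f]. Paths starting in other trees are unchanged. *)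
Lemma opt_decrease f g h : opt f -> opt g -> g h = None ->
  (forall z, f z = None -> rt g z != h) ->
  exists H, [/\ opt H, #|sinks H|.+1 = #|sinks g| &
    forall z, rt g z != h -> rt H z = rt g z].
Proof.
move=> of_ og gh nr; have af := opt_acyc of_; have ag := opt_acyc og.
pose C := component f g h (rt (restr f (tree g h)) h).
have oH : opt (mix C f g) by apply: opt_mix_comp.
exists (mix C f g); split=> //.
  rewrite (cardsD1 h (sinks g)) sinks_mem gh eqxx add1n; congr _.+1.
  apply: eq_card => z; rewrite !inE mixE component_mem.
  have [->|nzh] := eqVneq z h.
    rewrite root_in_tree //= eqxx; apply/eqP => fh.
    by move: (nr _ fh); rewrite rt_root ?eqxx.
  case: ifP => //= /andP[zS _]; rewrite (_ : (g z == None) = false).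
    by apply/eqP => fz; move: (nr _ fz) zS; rewrite inE => /negPf ->.
  by apply: contraNF nzh => /eqP /(tree_root ag zS) ->.
move=> z nz; apply/esym; apply: (@rt_agree _ _ _ (~: tree g h)) => //; first exact: opt_acyc.
- by move=> a; rewrite in_setC mixE component_mem => /negPf ->.
- by move=> a b; rewrite !in_setC => aS /(tree_next h ag) ->.
by rewrite !inE.
Qed.

End OptimalForests.

(** * Separating two vertices of one tree *)

Section Separation.
Variables (T : finType) (R : realFieldType) (V : rel T) (c : T -> option T -> R).
Variables (f g : {ffun T -> option T}) (h : T).
Hypotheses (of_ : opt V c f) (og : opt V c g) (gh : g h = None).
Hypothesis eqk : #|sinks f| = #|sinks g|.
Let S := tree g h.
Let fS := restr f S.
Let Cof x := component f g h (rt fS x).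
Let arc a b := step f a b || step g a b.
(** For [x] in [S], the least set containing [x] and closed inside its component under both kinds of
    arcs, hence a part that [opt_mix_part] may exchange. *)
Let Reach x := [set z | connect (fun a b => (b \in Cof x) && arc a b) x z].
Let af := opt_acyc of_.
Let ag := opt_acyc og.
Let afS : acyc fS := restr_acyc af.

Let separated x y := exists H,
  [/\ opt V c H, #|sinks H| = #|sinks g| & rt H x != rt H y].

Let Cof_mem x z : (z \in Cof x) = (z \in S) && (rt fS z == rt fS x).
Proof. exact: component_mem. Qed.

Let reach_refl x : x \in Reach x.
Proof. by rewrite inE. Qed.

Let reach_sub x : x \in S -> Reach x \subset Cof x.
Proof.
move=> xS; apply/subsetP => z; rewrite [z \in Reach x]inE => xz.
apply: (connect_stable _ _ xz) => [a b _ /andP[]//|]; by rewrite Cof_mem xS eqxx.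
Qed.

Let reach_next x z z' : z \in Reach x -> arc z z' -> z' \in Cof x -> z' \in Reach x.
Proof.
rewrite [z \in _]inE [z' \in Reach x]inE => xz a z'C; apply: connect_trans xz (connect1 _).
by rewrite z'C.
Qed.

Let reach_tree x z : x \in S -> z \in Reach x -> z \in S.
Proof. by move=> xS /(subsetP (reach_sub xS)); rewrite Cof_mem => /andP[]. Qed.

Let reach_f x z z' : x \in S -> z \in Reach x -> f z = Some z' -> z' \in S ->
  z' \in Reach x.
Proof.
move=> xS zP fz z'S; have zS := reach_tree xS zP.
apply: (reach_next zP); first by rewrite /arc /step fz eqxx.
by rewrite /Cof /component (component_next af _ zS fz z'S) (subsetP (reach_sub xS)).
Qed.

Let opt_reach x : x \in S -> opt V c (mix (Reach x) f g).
Proof.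
move=> xS; apply: (opt_mix_part of_ og (reach_sub xS)) => z z' zP e z'C;
  by apply: reach_next zP _ z'C; rewrite /arc /step e eqxx ?orbT.
Qed.

(** The forests packed, [FS] and [GP], both follow [f] on [Reach x] and [g] outside [S]. So does
    their mixture [m], hence [x] never gets to [h], while the packing leads [y] there. What remains
    is to correct the number of trees, possibly one too large. *)
Lemma separate_half x y : x \in S -> y \in S -> rt fS x != rt fS y ->
  h \notin Reach x ->
  connect (fun a b => step (mix S f g) a b || step (mix (Reach x) f g) a b) y h ->
  separated x y.
Proof.
move=> xS yS nxy hP yh; pose P := Reach x.
pose FS := mix S f g; pose GP := mix P f g.
have oFS : opt V c FS by apply: opt_mix_tree.
have oGP : opt V c GP by apply: opt_reach.
have GPh : GP h = None by rewrite mixE (negPf hP).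
have [W [D [hW inW cW oW [hD a1 a2]]]] :=
  disjoint_branchings (opt_acyc oFS) (opt_acyc oGP) GPh.
set m := mix D GP FS in cW a1.
have om : opt V c m by apply: opt_mix.
have mh : m h = None by rewrite mixE hD.
have cWm a b : a \in W -> m a = Some b -> b \in W.
  move=> aW ma; have ah : a != h by apply: contra_eq_neq ma => ->; rewrite mh.
  by have /staysP[b'] := cW a aW ah; rewrite ma => -[->].
have rtW z : z \in W -> rt m z = h.
  move=> zW; have rW := rt_closed a1 cWm zW; apply/eqP; apply: contraT => nh.
  by have /staysP[b'] := cW _ rW nh; rewrite (rtP z a1).1.
have yW : y \in W.
  case/connectP: yh => p pth e; move: hW; rewrite {}e => {mh hD GPh}.
  elim: p y pth {yS nxy} => //= a p IHp z /andP[za pth] /(IHp _ pth) aW.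
  by apply: inW aW; case/orP: za => /eqP; [left | right].
have mP z : z \in P -> m z = f z.
  by move=> zP; rewrite !mixE zP (reach_tree xS zP); case: ifP.
have mO z : z \notin S -> m z = g z.
  move=> zS; have zP : z \notin P by apply: contra zS; apply: reach_tree.
  by rewrite !mixE (negPf zP) (negPf zS); case: ifP.
pose B := P :|: ~: S.
have cB a b : a \in B -> m a = Some b -> b \in B.
  rewrite !in_setU !in_setC => /orP[aP|aS].
    rewrite mP // => fa; have [bS|//] := boolP (b \in S); last by rewrite orbT.
    by rewrite (reach_f xS aP fa bS).
  by rewrite mO // => /(tree_next h ag); rewrite -/S => ->; rewrite aS orbT.
have hS : h \in S by apply: root_in_tree.
have hB : h \notin B by rewrite in_setU in_setC hS orbF.
have WB z : z \in W -> z \notin B.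
  by move=> zW; apply: contra hB => zB; rewrite -(rtW z zW); apply: rt_closed.
have sep : rt m x != rt m y.
  rewrite (rtW y yW); apply: contraNneq hB => <-.
  by apply: rt_closed; rewrite // in_setU reach_refl.
have WSP z : z \in W -> (z \in S) && (z \notin P).
  by move/WB; rewrite in_setU in_setC negb_or negbK andbC.
have mW z : z \notin W -> m z = GP z by move=> /oW zD; rewrite mixE zD.
(* Inside [W] the only root is [h], and outside [W] the forest is [GP]. *)
have smE z : (m z == None) = (g z == None) || ((z \in P) && (f z == None)).
  have [zW|zW] := boolP (z \in W).
    have /andP[zS zP] := WSP z zW; rewrite (negPf zP) orbF.
    have [->|zh] := eqVneq z h; first by rewrite mh gh.
    have /staysP[z' -> _] := cW z zW zh.
    by apply/esym/eqP => /(tree_root ag zS) e; rewrite e eqxx in zh.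
  rewrite mW // mixE; case: ifP => zP /=; last by rewrite orbF.
  rewrite (_ : (g z == None) = false) //; apply/eqP => gz.
  by move: hP; rewrite -(tree_root ag (reach_tree xS zP) gz) zP.
(* The only root of [f] that [Reach x] can contain is the root of its component; if there is none,
   [m] has the right number of trees. *)
have [/exists_inP[r rP /eqP fr]|nor] := boolP [exists (r | r \in P), f r == None]; last first.
  exists m; split=> //; apply: eq_card => z; rewrite !inE smE.
  have [zP|//] := boolP (z \in P); last by rewrite orbF.
  by rewrite (negPf (exists_inPn nor z zP)) orbF.
have Cr z : z \in P -> fS z = None -> z = rt fS x.
  move=> /(subsetP (reach_sub xS)) zC rz; exact: component_root zC rz.
have er : r = rt fS x by apply: Cr => //; apply: restr_root.
have PS z z' : z \in P -> f z = Some z' -> z' \in S.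
  move=> zP fz; apply: contraT => z'S.
  have fSz : fS z = None by rewrite ffunE fz (negPf z'S).
  by move: fz; rewrite (Cr z zP fSz) -er fr.
have rS : r \in S := reach_tree xS rP.
have rg : r \notin sinks g.
  rewrite sinks_mem; apply/eqP => gr.
  by move: hP; rewrite -(tree_root ag rS gr) rP.
have cSm a b : a \in S -> m a = Some b -> b \in S.
  move=> aS; have [aW /(cWm _ _ aW) /WSP/andP[]//|aW] := boolP (a \in W).
  rewrite mW // mixE; case: ifP => [aP|_]; first exact: PS.
  by move/(tree_next h ag); rewrite -/S => ->.
have cm : #|sinks m| = #|sinks g|.+1.
  have -> : #|sinks g|.+1 = #|r |: sinks g| by rewrite cardsU1 rg.
  apply: eq_card => z; rewrite !inE smE orbC; congr orb.
  have [->|nzr] := eqVneq z r; first by rewrite rP fr eqxx.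
  apply/andP => -[zP /eqP fz]; move: nzr; rewrite er -(Cr z zP) ?eqxx //.
  exact: restr_root.
(* A tree of [g] other than [S] without roots of [f] is also a tree of [m]; dissolving it by
   [opt_decrease] leaves the roots of [x] and [y] alone. *)
have [/existsP[h0 /and3P[/eqP gh0 nh0 nor]]|all_f] :=
    boolP [exists h0, [&& g h0 == None, h0 != h &
      [forall z, (f z == None) ==> (rt g z != h0)]]].
  have h0S : h0 \notin S by rewrite inE rt_root.
  have mh0 : m h0 = None by rewrite mO.
  have nor' z : f z = None -> rt m z != h0.
    move=> fz; have [zS|zS] := boolP (z \in S).
      by apply: contraNneq h0S => <-; apply: rt_closed zS.
    rewrite -(@rt_agree _ g m (~: S)) ?in_setC //.
    - by move/forallP/(_ z): nor; rewrite fz eqxx.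
    - by move=> a; rewrite in_setC => /mO.
    - by move=> a b; rewrite !in_setC => aS /(tree_next h ag) ->.
  have [H [oH cH eH]] := opt_decrease of_ om mh0 nor'.
  exists H; split=> //; first by move: cH; rewrite cm => -[].
  rewrite !eH //; first by rewrite (rtW y yW) eq_sym.
  by apply: contraNneq h0S => <-; apply: rt_closed.
(* Every other tree of [g] now holds a root of [f], and the root counts agree, so at most one root
   of [f] is left for [S]. *)
have cS1 : #|sinks f :&: S| <= 1.
  have le : #|sinks g :\ h| <= #|sinks f :\: S|.
    apply: leq_trans (leq_imset_card (rt g) _); apply: subset_leq_card.
    apply/subsetP => h0; rewrite !inE => /andP[nh0 gh0].
    move/existsPn/(_ h0): all_f; rewrite gh0 nh0 /= negb_forall => /existsP[z].
    rewrite negb_imply negbK => /andP[fz /eqP ez]; apply/imsetP; exists z => //.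
    by rewrite !inE fz ez nh0.
  have := cardsID S (sinks f); rewrite eqk (cardsD1 h (sinks g)) sinks_mem gh eqxx.
  by move=> e; rewrite -(leq_add2r #|sinks f :\: S|) e leq_add2l.
have only z : z \in S -> f z = None -> z = r.
  move=> zS fz; have/card_le1P := cS1 => /(_ r); rewrite !inE fr -/S.
  have e1 : r \in sinks f :&: S by rewrite in_setI sinks_mem fr rS.
  have e2 : z \in sinks f :&: S by rewrite in_setI sinks_mem fz zS.
  by move=> _; apply: (card_le1_eqP cS1).
(* In [FS] the root [h] gives way to [r]. Since [r] is a root of [f], [x] ends in its own component,
   while [y] ends in [Cof y] or outside [S]. *)
exists FS; split=> //.
  have -> : sinks FS = r |: (sinks g :\ h).
    apply/setP => z; rewrite !inE mixE.
    have [zS|zS] := boolP (z \in S).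
      have [->|nzr] := eqVneq z r; first by rewrite fr.
      have -> : (f z == None) = false by apply: contraNF nzr => /eqP/(only _ zS) ->.
      have [//|nzh] := eqVneq z h; apply/esym/eqP => /(tree_root ag zS) e.
      by rewrite e eqxx in nzh.
    have [ezr|_] := eqVneq z r; first by rewrite ezr rS in zS.
    by have [ezh|_] := eqVneq z h; first by rewrite ezh hS in zS.
  by rewrite cardsU1 in_setD1 (negPf rg) andbF (cardsD1 h (sinks g)) sinks_mem gh eqxx.
have aFS := opt_acyc oFS.
have xC : rt FS x \in Cof x.
  apply: rt_closed => //; last by rewrite Cof_mem xS eqxx.
  move=> a b aC; have /andP[aS /eqP ea] : (a \in S) && (rt fS a == rt fS x) by rewrite -Cof_mem.
  rewrite mixE aS => fa; have [bS|bS] := boolP (b \in S).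
    by rewrite /Cof /component (component_next af _ aS fa bS).
  have fSa : fS a = None by rewrite ffunE fa (negPf bS).
  by move: fa; rewrite -(rt_root afS fSa) ea -er fr.
apply: contraTneq xC => ->.
have: rt FS y \in Cof y :|: ~: S.
  apply: rt_closed => //; last by rewrite in_setU Cof_mem yS eqxx.
  move=> a b; rewrite !in_setU !in_setC => /orP[aC|aS]; last first.
    by rewrite mixE (negPf aS) => /(tree_next h ag); rewrite -/S => ->; rewrite aS orbT.
  have aS : a \in S by move: aC; rewrite Cof_mem => /andP[].
  rewrite mixE aS => fa; have [bS|bS] := boolP (b \in S); last by rewrite orbT.
  by rewrite /Cof /component (component_next af _ aS fa bS) -/(component f g h _) -/(Cof y) aC.
rewrite in_setU in_setC !Cof_mem; case: (_ \in S) => //=; rewrite orbF => /eqP ->.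
by rewrite eq_sym.
Qed.

(** Only the vertices after the first must avoid [A]; the starting vertex may lie in it. *)
Lemma last_visit (A : {set T}) z : connect (step g) z h ->
  connect (fun a b => step g a b && (b \notin A)) z h \/
  exists2 w, w \in A & connect (fun a b => step g a b && (b \notin A)) w h.
Proof.
case/connectP => p pth e; elim: p z pth e => [|a p IHp] z /=; first by move=> _ ->; left.
case/andP => za pth e; have [ah|] := IHp a pth e; last by right.
have [aA|aA] := boolP (a \in A); first by right; exists a.
by left; apply: connect_trans ah; apply: connect1; rewrite za.
Qed.

(* [x] and [y] reach all of their own [Reach] sets without touching the other's,
   so whichever set a path to [h] visits last can be connected to [h] off the other. *)
Lemma separate x y : x \in S -> y \in S -> rt fS x != rt fS y -> separated x y.
Proof.
move=> xS yS nxy.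
have half x' y' (w : T) : x' \in S -> y' \in S -> rt fS x' != rt fS y' -> w \in Reach y' ->
    connect (fun a b => step g a b && (b \notin Reach x' :|: Reach y')) w h ->
    separated x' y'.
  move=> x'S y'S n wP wh.
  have dis z : z \in Cof y' -> z \notin Reach x'.
    rewrite Cof_mem => /andP[_ /eqP e]; apply/negP => /(subsetP (reach_sub x'S)).
    by rewrite Cof_mem e eq_sym (negPf n) andbF.
  have wC := subsetP (reach_sub y'S) w wP.
  have stp a : a \notin Reach x' -> mix (Reach x') f g a = g a.
    by move=> /negPf aP; rewrite mixE aP.
  have hP : h \notin Reach x'.
    have: h \in ~: Reach x'.
      apply: connect_stable wh => [a b _ /andP[_]|]; last by rewrite in_setC dis.
      by rewrite in_setU negb_or in_setC => /andP[].
    by rewrite in_setC.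
  apply: separate_half => //; apply: (@connect_trans _ _ w).
    (* Inside [Cof y'], which lies in [S] and misses [Reach x'], [f]-arcs belong to [mix S f g] and
       [g]-arcs to [mix (Reach x') f g]. *)
    move: wP; rewrite inE => /connectP[p pth ->] {w wh wC}.
    have y'C : y' \in Cof y' by rewrite Cof_mem y'S eqxx.
    pose z := y'; rewrite -[X in connect _ X]/z -[X in last X]/z.
    have {y'C pth} [zC pth] : z \in Cof y' /\ path (fun a b => (b \in Cof y') && arc a b) z p.
      by [].
    elim: p z zC pth => //= a p IHp z zC /andP[/andP[aC za] pth].
    apply: connect_trans (IHp _ aC pth); apply: connect1.
    have zS : z \in S by move: zC; rewrite Cof_mem => /andP[].
    by move: za; rewrite /arc /step mixE zS stp ?dis.
  case/connectP: wh => p pth e; rewrite e.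
  have := dis w wC; elim: p w pth {wP wC e} => //= a p IHp z /andP[/andP[za aA] pth] zP.
  move: aA; rewrite in_setU negb_or => /andP[aA _].
  apply: connect_trans (IHp _ pth aA); apply: connect1.
  by rewrite /step stp // -/(step g z a) za orbT.
have xh : connect (step g) x h.
  by have [_] := rtP x ag; move: xS; rewrite inE => /eqP ->.
have [w wA wh] : exists2 w, w \in Reach x :|: Reach y &
    connect (fun a b => step g a b && (b \notin Reach x :|: Reach y)) w h.
  by have [?|//] := last_visit (Reach x :|: Reach y) xh; exists x; rewrite // in_setU reach_refl.
case/setUP: wA => wA; last exact: half wA wh.
rewrite setUC in wh; rewrite eq_sym in nxy.
have [H [oH cH nH]] := half y x w yS xS nxy wA wh.
by exists H; rewrite eq_sym.
Qed.

End Separation.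

(** * Convexity of the minimal weight and supporting slopes *)

Local Open Scope ring_scope.

Lemma interval_point (R : realFieldType) (I : finType) (P Q : pred I) (a b : I -> R) :
  (forall i j, P i -> Q j -> a i <= b j) ->
  exists l, (forall i, P i -> a i <= l) /\ (forall j, Q j -> l <= b j).
Proof.
move=> ab; case: (pickP P) => [i0 Pi0|noP].
  have [i Pi maxi] := @arg_maxP _ _ _ i0 P a Pi0.
  by exists (a i); split=> // j; apply: ab.
case: (pickP Q) => [j0 Qj0|noQ].
  have [j Qj minj] := @arg_minP _ _ _ j0 Q b Qj0.
  by exists (b j); split=> // i; rewrite noP.
by exists 0; split=> i; rewrite ?noP ?noQ.
Qed.

Section ChordArithmetic.
Variable R : realFieldType.
Implicit Types m l K s t w : R.

(** A chord ending on the line [m + l * n] at [t] and not below it at [K] starts at a point not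
    below the line. *)
Lemma chord_below_left m l K s t w : 0 < t - K ->
  (t - s) * (m + l * K) <= (t - K) * w + (K - s) * (m + l * t) -> m <= w - l * s.
Proof.
move=> p le; have : (t - K) * (m + l * s) <= (t - K) * w by lra.
by rewrite ler_pM2l //; lra.
Qed.

Lemma chord_below_right m l K s t w : 0 < K - s ->
  (t - s) * (m + l * K) <= (t - K) * (m + l * s) + (K - s) * w -> m <= w - l * t.
Proof.
move=> p le; have : (K - s) * (m + l * t) <= (K - s) * w by lra.
by rewrite ler_pM2l //; lra.
Qed.

Lemma chord_slopes K s t w w1 w2 : s < K -> K < t ->
  (t - s) * w <= (t - K) * w1 + (K - s) * w2 -> (w1 - w) / (s - K) <= (w2 - w) / (t - K).
Proof.
move=> sK Kt le; rewrite -[X in X <= _]mulrNN -invrN !opprB.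
by rewrite ler_pdivrMr ?subr_gt0 // mulrAC ler_pdivlMr ?subr_gt0 //; lra.
Qed.

Lemma chord_at K s t m l : t - s != 0 ->
  ((t - K) * (m + l * s) + (K - s) * (m + l * t)) / (t - s) = m + l * K.
Proof. by move=> d; field. Qed.

Lemma slope_left l s t w w' : s < t -> (w' - w) / (s - t) <= l -> w - l * t <= w' - l * s.
Proof.
move=> st; rewrite -[X in X <= _]mulrNN -invrN !opprB ler_pdivrMr ?subr_gt0 //; lra.
Qed.

Lemma slope_right l s t w w' : t < s -> l <= (w' - w) / (s - t) -> w - l * t <= w' - l * s.
Proof. by move=> ts; rewrite ler_pdivlMr ?subr_gt0 //; lra. Qed.

End ChordArithmetic.

Section Slope.
Variables (T : finType) (R : realFieldType) (V : rel T) (v : T -> T -> R).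
Implicit Types (f g H A B : {ffun T -> option T}).

(** [l] is a Lagrange multiplier for the number of trees: each root earns [l]. *)
Definition arc_cost (l : R) (z : T) (o : option T) : R :=
  if o is Some j then v z j else - l.

Definition arc_weight f : R := cost (arc_cost 0) f.

Lemma cost_arc_cost l f : cost (arc_cost l) f = arc_weight f - l * #|sinks f|%:R.
Proof.
rewrite /arc_weight /cost mulr_natr -sumr_const.
rewrite (big_mkcond (mem (sinks f))) /= -sumrB; apply: eq_bigr => z _.
by rewrite !inE; case: (f z) => [j|] /=; rewrite ?subr0 // oppr0 add0r.
Qed.

Definition feasible f :=
  [forall X : {set T}, [forall (z | z \in X), stays f X z] ==> (X == set0)] &&
  [forall z, if f z is Some z' then V z z' else true].

Lemma feasibleP f : reflect (acyc f /\ allowed V f) (feasible f).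
Proof.
apply: (iffP andP) => -[af vf]; split.
- move=> X cX; apply/eqP; move/forallP/(_ X)/implyP: af; apply.
  by apply/forall_inP.
- by move=> z z' fz; move/forallP/(_ z): vf; rewrite fz.
- by apply/forallP => X; apply/implyP => /forall_inP cX; apply/eqP/af.
by apply/forallP => z; case E: (f z) => [z'|//]; apply: vf.
Qed.

(** [opt_increase] adds one tree at a time and preserves optimality. *)
Lemma opt_between l k A B : opt V (arc_cost l) A -> opt V (arc_cost l) B ->
  (#|sinks A| <= k <= #|sinks B|)%N ->
  exists2 H, opt V (arc_cost l) H & #|sinks H| = k.
Proof.
move=> + oB /andP[+ kB]; move En: (k - #|sinks A|)%N => n.
elim: n A En => [|n IHn] A En oA Ak.
  by exists A => //; apply/eqP; rewrite eqn_leq Ak -subn_eq0 En.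
have AltK : (#|sinks A| < k)%N by rewrite -subn_gt0 En.
have [A' oA' cA'] := opt_increase oB oA (leq_trans AltK kB).
by apply: (IHn A'); rewrite // cA' // subnS En.
Qed.

(* A pair of forests violating the claim and minimising the value at [k] of the
   chord through them spans an edge of the lower convex hull, so both its ends
   are optimal for the slope of this edge. *)
Lemma chord_above k A B : feasible A -> feasible B ->
  (#|sinks A| < k < #|sinks B|)%N ->
  exists2 H, feasible H && (#|sinks H| == k) &
    (#|sinks B|%:R - #|sinks A|%:R) * arc_weight H <=
    (#|sinks B|%:R - k%:R) * arc_weight A + (k%:R - #|sinks A|%:R) * arc_weight B.
Proof.
move=> fA fB /andP[Ak kB].
pose w := arc_weight; pose t (H : {ffun T -> option T}) : R := #|sinks H|%:R.
pose K : R := k%:R.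
pose P (p : {ffun T -> option T} * {ffun T -> option T}) :=
  [&& feasible p.1, feasible p.2, (#|sinks p.1| < k)%N & (k < #|sinks p.2|)%N].
pose I (p : {ffun T -> option T} * {ffun T -> option T}) :=
  ((t p.2 - K) * w p.1 + (K - t p.1) * w p.2) / (t p.2 - t p.1).
have P0 : P (A, B) by rewrite /P /= fA fB Ak kB.
have tlt H : (#|sinks H| < k)%N -> 0 < K - t H by rewrite subr_gt0 ltr_nat.
have tgt H : (k < #|sinks H|)%N -> 0 < t H - K by rewrite subr_gt0 ltr_nat.
have [[A1 B1] /and4P[/= fA1 fB1 A1k kB1] minI] := @arg_minP _ _ _ (A, B) P I P0.
have sub_gt0 A' B' : (#|sinks A'| < k)%N -> (k < #|sinks B'|)%N -> 0 < t B' - t A'.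
  by move=> A'k kB'; rewrite subr_gt0 ltr_nat (ltn_trans A'k).
pose l := (w B1 - w A1) / (t B1 - t A1).
pose m := w A1 - l * t A1.
have d1 : t B1 - t A1 != 0 by rewrite gt_eqF // sub_gt0.
have wA1 : w A1 = m + l * t A1 by rewrite /m subrK.
have wB1 : w B1 = m + l * t B1.
  by rewrite /m addrAC -addrA -mulrBr /l mulfVK // addrC subrK.
have I1 : I (A1, B1) = m + l * K by rewrite /I /= wA1 wB1 chord_at.
have minIm A' B' : P (A', B') ->
    (t B' - t A') * (m + l * K) <= (t B' - K) * w A' + (K - t A') * w B'.
  move=> P'; have := minI _ P'; rewrite I1 /I /=.
  have /and4P[_ _ /= A'k kB'] := P'.
  by rewrite ler_pdivlMr ?sub_gt0 // mulrC.
have [/existsP[H /and3P[fH /eqP kH lH]]|noH] :=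
  boolP [exists H, [&& feasible H, #|sinks H| == k & w H <= m + l * K]].
  exists H; first by rewrite fH kH eqxx.
  by have := minIm _ _ P0; apply: le_trans; rewrite ler_wpM2l // ltW // sub_gt0.
(* A forest below the line would give, with [A1] or [B1], a chord lower at [k]; one with exactly [k]
   trees is excluded by [noH]. *)
have optm H : feasible H -> m <= cost (arc_cost l) H.
  move=> fH; rewrite cost_arc_cost -/(w H) -/(t H).
  have [Hk|kH|Hk] := ltngtP #|sinks H| k.
  - have := minIm H B1; rewrite /P /= fH fB1 Hk kB1 => /(_ isT).
    by rewrite wB1; apply: chord_below_left; apply: tgt.
  - have := minIm A1 H; rewrite /P /= fH fA1 A1k kH => /(_ isT).
    by rewrite wA1; apply: chord_below_right; apply: tlt.
  move/existsPn/(_ H): noH; rewrite fH Hk eqxx /= -ltNge => /ltW.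
  by rewrite /t Hk -/K lerBrDr.
have oA1 : opt V (arc_cost l) A1.
  have [aA vA] := feasibleP _ fA1; split=> // g ag vg.
  apply: le_trans (optm g _); last by apply/feasibleP.
  by rewrite cost_arc_cost -/(w A1) -/(t A1) /m.
have oB1 : opt V (arc_cost l) B1.
  have [aB vB] := feasibleP _ fB1; split=> // g ag vg.
  apply: le_trans (optm g _); last by apply/feasibleP.
  by rewrite cost_arc_cost -/(w B1) -/(t B1) wB1 addrK.
have [H oH cH] : exists2 H, opt V (arc_cost l) H & #|sinks H| = k.
  by apply: (opt_between oA1 oB1); rewrite (ltnW A1k) (ltnW kB1).
have [aH vH mH] := oH; have [aA vA] := feasibleP _ fA1.
move/existsPn/(_ H): noH; have -> : feasible H by apply/feasibleP.
rewrite cH eqxx /= => /negP[]; have := mH _ aA vA.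
by rewrite !cost_arc_cost cH -/(w A1) -/(t A1) -/m lerBlDr.
Qed.

(** By [chord_above], slopes from [f] to forests with fewer trees never exceed slopes to forests
    with more; any [l] in between supports [f]. *)
Lemma supporting_slope f : feasible f ->
  (forall H, feasible H -> #|sinks H| = #|sinks f| -> arc_weight f <= arc_weight H) ->
  exists l, opt V (arc_cost l) f.
Proof.
move=> ff minf; pose t (H : {ffun T -> option T}) : R := #|sinks H|%:R.
pose w := arc_weight.
pose s H := (w H - w f) / (t H - t f).
have [A B|l [lo hi]] := @interval_point R _
    [pred H | feasible H && (#|sinks H| < #|sinks f|)%N]
    [pred H | feasible H && (#|sinks f| < #|sinks H|)%N] s s.
  case/andP => /= fA Af /andP[fB fBl].
  have [|H /andP[fH /eqP cH] le] := @chord_above #|sinks f| A B fA fB; first by rewrite Af fBl.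
  have pA : t A < t f by rewrite ltr_nat.
  have pB : t f < t B by rewrite ltr_nat.
  have wH : w f <= w H by apply: minf.
  apply: chord_slopes => //; apply: le_trans le.
  by rewrite ler_wpM2l // subr_ge0 ltW // (lt_trans pA).
have [af vf] := feasibleP _ ff; exists l; split=> // g ag vg.
have fg : feasible g by apply/feasibleP.
rewrite !cost_arc_cost -/(w _) -/(w _) -/(t _) -/(t _).
have [gf|fg'|e] := ltngtP #|sinks g| #|sinks f|.
- by apply: slope_left; rewrite ?ltr_nat //; apply: lo; rewrite /= fg.
- by apply: slope_right; rewrite ?ltr_nat //; apply: hi; rewrite /= fg.
by rewrite /t e lerD2r; apply: minf.
Qed.

End Slope.

(** * Translation between arc sets and successor functions *)

Section ArcSets.
Variable T : finType.
Implicit Types (f g : {ffun T -> option T}) (A : {set T * T}).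

Definition arcs f : {set T * T} := [set a | f a.1 == Some a.2].

Definition next A : {ffun T -> option T} := [ffun i => [pick j | (i, j) \in A]].

Lemma arc_rel_arcs f : arc_rel (arcs f) =2 step f.
Proof. by move=> i j; rewrite /arc_rel inE. Qed.

Lemma nextK A : out_le1 A -> arcs (next A) = A.
Proof.
move=> oA; apply/setP => -[i j]; rewrite inE ffunE /=; case: pickP => [j' ij'|no].
  apply/eqP/idP => [[<-] //|ij]; congr Some.
  by apply: (card_le1_eqP (oA i)); rewrite inE.
by rewrite no.
Qed.

Lemma arcs_out_le1 f : out_le1 (arcs f).
Proof.
move=> i; apply/card_le1_eqP => j j'; rewrite !inE /= => /eqP -> /eqP[].
by [].
Qed.

Lemma acyc_arcs f : acyc f <-> acyclic (arcs f).
Proof.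
split=> [af i j|aA X cX].
  rewrite arc_rel_arcs (eq_connect (arc_rel_arcs f)) => /eqP fi; apply/negP => ji.
  suff X0 : [set u | connect (step f) j u && connect (step f) u i] = set0.
    by move/setP/(_ j): X0; rewrite !inE connect0 ji.
  apply: af => u; rewrite inE => /andP[ju ui]; apply/staysP.
  have [e|[u' fu u'i]] := connect_stepE ui.
    by exists j; rewrite ?e // inE connect0 ji.
  exists u' => //; rewrite inE u'i andbT; apply: connect_trans ju (connect1 _).
  by rewrite /step fu.
apply/eqP; apply: contraT => /set0Pn[x0 x0X].
(* Take a vertex of [X] reaching the fewest vertices: without cycles, its successor reaches strictly
   fewer. *)
have [x xX minx] := @arg_minnP _ x0 (mem X) (fun x => #|connect (step f) x|) x0X.
have /staysP[x' fx x'X] := cX x xX.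
have xx' : connect (step f) x x' by apply: connect1; rewrite /step fx.
have nx'x : ~~ connect (step f) x' x.
  by rewrite -(eq_connect (arc_rel_arcs f)); apply: aA; rewrite arc_rel_arcs /step fx.
have := minx x' x'X; rewrite leqNgt => /negP[]; apply: proper_card; apply/properP; split.
  by apply/subsetP => u; apply: connect_trans.
by exists x; rewrite ?inE //; apply: connect0.
Qed.

Lemma connect_rt f (e : rel T) x : acyc f -> (forall a b, step f a b -> e a b) ->
  connect e x (rt f x).
Proof.
move=> af fe; have [_] := rtP x af; apply: connect_sub => a b ab.
exact/connect1/fe.
Qed.

Lemma wconnect_sym A : connect_sym (fun i j => arc_rel A i j || arc_rel A j i).
Proof. by apply: sym_connect_sym => x y; rewrite orbC. Qed.

Lemma rt_wconnect f A x y : acyc f -> (forall a b, step f a b -> (a, b) \in A) ->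
  rt f x = rt f y -> wconnect A x y.
Proof.
move=> af fA e; have xr z : wconnect A z (rt f z).
  by apply: connect_rt => // a b /fA ab; rewrite /arc_rel ab.
by apply: connect_trans (xr x) _; rewrite e wconnect_sym; apply: xr.
Qed.

Lemma wconnect_arcs f x y : acyc f -> wconnect (arcs f) x y = (rt f x == rt f y).
Proof.
move=> af; apply/idP/eqP; last by apply: rt_wconnect => // a b; rewrite inE.
move=> xy; have: y \in [set z | rt f x == rt f z]; last by rewrite inE => /eqP.
apply: connect_stable xy => [a b|]; last by rewrite inE.
rewrite !inE !arc_rel_arcs => /eqP ->; case/orP => /eqP e.
  by rewrite (rt_Some af e).
by rewrite (rt_Some af e).
Qed.

Lemma num_trees_arcs f : acyc f -> num_trees (arcs f) = #|sinks f|.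
Proof.
move=> af; rewrite /num_trees /tree_sets.
have -> : [set [set y | wconnect (arcs f) x y] | x : T] =
          [set [set y | rt f y == x] | x in sinks f].
  apply/setP => X; apply/imsetP/imsetP => -[x xP ->].
    exists (rt f x); first by rewrite sinks_mem (rtP x af).1.
    by apply/setP => y; rewrite !inE wconnect_arcs // eq_sym.
  exists x => //; apply/setP => y; rewrite !inE wconnect_arcs // eq_sym (rt_root (z := x)) //.
  by apply/eqP; rewrite -sinks_mem.
apply: card_in_imset => x y; rewrite !sinks_mem => /eqP fx /eqP fy /setP/(_ x).
by rewrite !inE !rt_root // eqxx => /esym/eqP.
Qed.

Variables (R : realFieldType) (V : rel T) (v : T -> T -> R).

Lemma weight_arcs f : weight v (arcs f) = arc_weight v f.
Proof.
have -> : arc_weight v f = \sum_z \sum_(j | f z == Some j) v z j.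
  apply: eq_bigr => z _; case: (f z) => [j|] /=; last by rewrite oppr0 big_pred0.
  by rewrite (big_pred1 j) // => j' /=; rewrite [RHS]eq_sym.
by rewrite pair_big_dep /weight /=; apply: eq_bigl => -[i j]; rewrite inE.
Qed.

Lemma forest_next k A : forest_k V k A ->
  [/\ arcs (next A) = A, feasible V (next A) & #|sinks (next A)| = k].
Proof.
move=> [[vA oA aA] nA]; have e := nextK oA.
have an : acyc (next A) by apply/acyc_arcs; rewrite e.
split=> //; last by rewrite -num_trees_arcs // e.
apply/feasibleP; split=> // z z' nz; apply: vA; rewrite -e inE /=; exact/eqP.
Qed.

Lemma forest_arcs f : feasible V f -> forest_k V #|sinks f| (arcs f).
Proof.
case/feasibleP => af vf; split; last exact: num_trees_arcs.
split; [by move=> i j; rewrite inE => /eqP /vf | exact: arcs_out_le1 | exact/acyc_arcs].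
Qed.

Lemma minimal_next k A : minimal_forest V v k A -> forall g, feasible V g ->
  #|sinks g| = k -> arc_weight v (next A) <= arc_weight v g.
Proof.
move=> [fA mA] g fg cg; have [e _ _] := forest_next fA.
by rewrite -!weight_arcs e; apply: mA; rewrite -cg; apply: forest_arcs.
Qed.

Lemma opt_minimal l k f : opt V (arc_cost v l) f -> #|sinks f| = k ->
  minimal_forest V v k (arcs f).
Proof.
move=> [af vf mf] cf; split; first by rewrite -cf; apply: forest_arcs; apply/feasibleP.
move=> B fB; have [e fe ce] := forest_next fB; have [an vn] := feasibleP _ _ fe.
have := mf _ an vn; rewrite !cost_arc_cost cf ce lerD2r.
by rewrite -!weight_arcs e.
Qed.

Lemma minimal_opt k A B l : minimal_forest V v k A -> minimal_forest V v k B ->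
  opt V (arc_cost v l) (next A) -> opt V (arc_cost v l) (next B).
Proof.
move=> mA mB [_ _ oA]; have [eA fA cA] := forest_next mA.1.
have [eB fB cB] := forest_next mB.1; have [aB vB] := feasibleP _ _ fB.
split=> // g ag vg; apply: le_trans (oA g ag vg).
by rewrite !cost_arc_cost cA cB lerD2r; apply: (minimal_next mB).
Qed.

(** Minimal forests with [k] trees have equal weight and equally many roots, hence equal cost for
    any slope, so the slope of one serves all. *)
Lemma minimal_forest_slope k A : minimal_forest V v k A ->
  exists l, forall B, minimal_forest V v k B -> opt V (arc_cost v l) (next B).
Proof.
move=> mA; have [eA fA cA] := forest_next mA.1.
have [|l oA] := @supporting_slope _ _ V v (next A) fA.
  by move=> g fg cg; apply: (minimal_next mA) => //; rewrite cg.
by exists l => B mB; apply: (minimal_opt mA mB oA).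
Qed.

Lemma wconnect_next k A x y : forest_k V k A ->
  wconnect A x y = (rt (next A) x == rt (next A) y).
Proof.
move=> fA; have [e /feasibleP[an _] _] := forest_next fA.
by rewrite -{1}e wconnect_arcs.
Qed.

(** Trees of minimal forests are unions of classes of the relation of sharing a tree in every
    minimal forest, and the algebra operations preserve this. *)
Lemma algebra_saturated k S x y : algebra_k V v k S ->
  (forall G, minimal_forest V v k G -> wconnect G x y) -> (x \in S) = (y \in S).
Proof.
move=> aS xy; elim: aS => {S} [S [G [mG /imsetP[z _ ->]]]|S _ IH|S1 S2 _ IH1 _ IH2].
- have wxy := xy G mG; rewrite !inE; apply/idP/idP => zc; apply: connect_trans zc _ => //.
  by rewrite wconnect_sym.
- by rewrite !in_setC IH.
by rewrite !in_setI IH1 IH2.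
Qed.

Lemma atom_wconnect k E G x y : atom (algebra_k V v k) E -> minimal_forest V v k G ->
  x \in E -> y \in E -> wconnect G x y.
Proof.
move=> [_ _ aE] mG xE yE.
have aB : algebra_k V v k [set z | wconnect G x z].
  by apply: alg_gen; exists G; split=> //; apply: imset_f.
have [/setP/(_ x)|/setP/(_ y)] := aE _ aB; rewrite !inE ?xE ?yE //=.
by rewrite /wconnect connect0.
Qed.

(* If a minimal forest [G] separated [w] from [e], then [e], whose arc leaves the
   tree of [G] around it, and [e'] would be separated by some minimal forest. *)
Lemma exit_in_atom k E F e e' w : atom (algebra_k V v k) E -> minimal_forest V v k F ->
  e \in E -> e' \in E -> e != e' -> next F e = Some w ->
  ~~ connect (step (next F)) e' e -> w \in E.
Proof.
move=> aE mF eE e'E nee' Fe ne'e; have [_ algE _] := aE.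
rewrite -(@algebra_saturated k E e w algE) // => G mG; apply: contraT => sep.
have [l ol] := minimal_forest_slope mF; have oF := ol F mF; have oG := ol G mG.
have [_ /feasibleP[aF _] cF] := forest_next mF.1.
have [_ /feasibleP[aG _] cG] := forest_next mG.1.
pose h := rt (next G) e; pose S := tree (next G) h.
have gh : next G h = None := (rtP e aG).1.
have eS : e \in S by rewrite inE.
have e'S : e' \in S.
  by rewrite inE eq_sym -(wconnect_next _ _ mG.1) (atom_wconnect aE mG).
have wS : w \notin S by move: sep; rewrite (wconnect_next _ _ mG.1) inE eq_sym.
have aS := restr_acyc (S := S) aF.
have re : rt (restr (next F) S) e = e.
  by apply: rt_root => //; rewrite ffunE Fe (negPf wS).
have ne : rt (restr (next F) S) e != rt (restr (next F) S) e'.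
  rewrite re; apply: contraNneq ne'e => ->; apply: connect_rt => // a b.
  by rewrite /step ffunE; case: (next F a) => // a'; case: ifP.
have [|H [oH cH nH]] := separate oF oG gh _ eS e'S ne; first by rewrite cF cG.
have mH : minimal_forest V v k (arcs H) by apply: opt_minimal oH _; rewrite cH.
have := atom_wconnect aE mH eE e'E.
by rewrite (wconnect_arcs _ _ (opt_acyc oH)) (negPf nH).
Qed.

End ArcSets.

(** * Connectedness of minimal forests on atoms *)

Theorem theorem5 (R : realFieldType) (T : finType) (V : rel T)
    (v : T -> T -> R) :
  (exists A : {set T * T}, forest_k V 1 A) ->
  forall (k : nat), (1 <= k <= #|T|)%N ->
  forall F : {set T * T}, minimal_forest V v k F ->
  forall E : {set T}, atom (algebra_k V v k) E ->
  weakly_connected_on E (induced F E).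
Proof.
move=> _ k _ F mF E aE x y xE yE.
have [eF /feasibleP[aF _] _] := forest_next mF.1.
set f := next F in eF aF; pose fE := restr f E; have afE : acyc fE := restr_acyc aF.
have cE a b : a \in E -> fE a = Some b -> b \in E.
  by move=> _; rewrite ffunE; case: (f a) => // b'; case: ifP => // b'E [<-].
(* Either the arc of [e] leaves the atom, which [exit_in_atom] forbids unless [e'] reaches [e], or
   [e] is the root of the tree of [F] containing the atom. *)
have stop e e' : e \in E -> e' \in E -> e != e' -> fE e = None ->
    connect (step f) e' e.
  move=> eE e'E nee' fEe; apply: contraT => ne'e; case fe: (f e) => [w|].
    have := exit_in_atom aE mF eE e'E nee' fe ne'e.
    by rewrite (negPf (restr_None fEe fe)).
  have := atom_wconnect aE mF eE e'E; rewrite (wconnect_next _ _ mF.1) -/f.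
  rewrite (rt_root aF fe) => /eqP er; move: ne'e; rewrite er.
  by rewrite (rtP e' aF).2.
have rtE z : z \in E -> rt fE z \in E by apply: rt_closed.
have rtN z : fE (rt fE z) = None := (rtP z afE).1.
(* Two distinct roots of the restriction would reach each other in [f], closing a cycle. *)
have exy : rt fE x = rt fE y.
  apply/eqP; apply: contraT => n; have xyc := stop _ _ (rtE x xE) (rtE y yE) n (rtN x).
  rewrite eq_sym in n; have yxc := stop _ _ (rtE y yE) (rtE x xE) n (rtN y).
  have [e|[z fz zc]] := connect_stepE xyc; first by rewrite e eqxx in n.
  have /acyc_arcs/(_ (rt fE y) z) := aF; rewrite arc_rel_arcs /step fz eqxx => /(_ isT).
  by rewrite (eq_connect (arc_rel_arcs f)) (connect_trans zc).
have up z : z \in E -> wconnect (induced F E) z (rt fE z).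
  move=> zE; have [_ /connectP[p pth ->]] := rtP z afE.
  elim: p z zE pth => [|b p IHp] z zE //=; first by rewrite /wconnect connect0.
  case/andP => /eqP zb pth; have bE := cE _ _ zE zb.
  apply: connect_trans (IHp _ bE pth); apply: connect1; rewrite /arc_rel !inE /= zE bE /= andbT.
  rewrite -eF inE /= -/f; move: zb; rewrite ffunE; case: (f z) => // b'.
  by case: ifP => // _ [->]; rewrite eqxx.
by apply: connect_trans (up x xE) _; rewrite exy wconnect_sym; apply: up.
Qed.
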